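(* Let $r\ge0$ be an integer. For every integer $n\ge0$ and every real $x$, $$\mathrm{LB}_{n}^{(r)}(x)=e^{-x}\sum_{k=0}^{\infty}\frac{\langle k+r\rangle_{n}}{k!}x^{k}.$$
   Context: Falling factorials: $(x)_0=1$, $(x)_n=x(x-1)\cdots(x-n+1)$ for $n\ge1$. Rising factorials: $\langle x\rangle_0=1$, $\langle x\rangle_n=x(x+1)\cdots(x+n-1)$ for $n\ge 1$. For an integer $r\ge0$, the $r$-Lah numbers $L^r(n,k)$ ($0\le k\le n$) are defined by the polynomial identity $\langle x+r\rangle_n=\sum_{k=0}^n L^r(n,k)(x)_k$ for $n\ge0$. The $r$-Lah-Bell polynomials are $\mathrm{LB}_n^{(r)}(x)=\sum_{k=0}^n L^r(n,k)x^k$ for $n\ge0$. *)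

(* Defs.v *)
From HB Require Import structures.
From mathcomp Require Import all_boot all_order all_algebra.
From mathcomp Require Import all_classical all_reals all_analysis.

Set Implicit Arguments.
Unset Strict Implicit.
Unset Printing Implicit Defensive.

Import Order.TTheory GRing.Theory Num.Theory.

Local Open Scope ring_scope.

(* Stated over an arbitrary commutative ring so that they apply both to the
   indeterminate of {poly R} and to elements of R. *)
Definition falling (A : comNzRingType) (x : A) (n : nat) : A :=
  \prod_(i < n) (x - i%:R).

Definition rising (A : comNzRingType) (x : A) (n : nat) : A :=
  \prod_(i < n) (x + i%:R).

(* The first clause is an identity in {poly R}; the second one fixes the
   values outside 0 <= k <= n, which the identity leaves undetermined. *)
Definition is_rLah (R : realType) (r : nat) (L : nat -> nat -> R) : Prop :=
  (forall n : nat, rising ('X + r%:R : {poly R}) n =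
                   \sum_(k < n.+1) L n k *: falling 'X k)
  /\ (forall n k : nat, (n < k)%N -> L n k = 0).

Lemma is_rLah_exists (R : realType) (r : nat) :
  exists L : nat -> nat -> R, is_rLah r L.
Proof.
pose L := fix L (n k : nat) {struct n} : R :=
  if n is n'.+1 then
    (if k is k'.+1 then L n' k' else 0) + (k + r + n')%:R * L n' k
  else (k == 0%N)%:R.
have L0 n k : (n < k)%N -> L n k = 0.
  elim: n k => [|n IHn] [|k] //= nk.
  by rewrite IHn // IHn ?mulr0 ?addr0 // (ltn_trans _ nk).
exists L; split=> //; elim=> [|n IHn].
  by rewrite /rising /falling big_ord1 !big_ord0 scale1r.
rewrite /rising big_ord_recr /= -/(rising _ n) IHn mulr_suml.
have E (k : 'I_n.+1) : L n k *: falling 'X k * ('X + r%:R + n%:R) =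
    L n k *: falling 'X k.+1 + ((k + r + n)%:R * L n k) *: falling 'X k
    :> {poly R}.
  rewrite /falling big_ord_recr /= -/(falling _ k) [_%:R * _]mulrC -scalerA.
  rewrite -scalerDr -scalerAl; congr (_ *: _).
  rewrite -mul_polyC polyC_natr !natrD mulrC -[X in _ = _ + X]mulrC -mulrDr.
  by rewrite mulrC !addrA subrK.
rewrite (eq_bigr _ (fun k _ => E k)) big_split /=.
under [RHS]eq_bigr do rewrite scalerDl.
rewrite [RHS]big_split /=; congr (_ + _).
  by rewrite [RHS]big_ord_recl /= scale0r add0r.
by rewrite [RHS]big_ord_recr /= (L0 n n.+1) // mulr0 scale0r addr0.
Qed.

Lemma is_rLah_unique (R : realType) (r : nat) (L L' : nat -> nat -> R) :
  is_rLah r L -> is_rLah r L' -> L = L'.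
Proof.
move=> [HL L0] [HL' L'0]; apply/funext => n; apply/funext => k.
have [nk|kn] := ltnP n k; first by rewrite L0 // L'0.
have horner_falling (j : nat) (x : R) : (falling 'X j).[x] = falling x j.
  rewrite /falling horner_prod; apply: eq_bigr => i _.
  by rewrite -polyC_natr hornerXsubC.
elim/ltn_ind: k kn => k IHk kn.
have := congr1 (fun p => p.[k%:R]) (etrans (esym (HL n)) (HL' n)).
rewrite !horner_sum (bigD1 (Ordinal (kn : (k < n.+1)%N))) //=.
rewrite [RHS](bigD1 (Ordinal (kn : (k < n.+1)%N))) //=.
have -> : \sum_(i < n.+1 | i != Ordinal (kn : (k < n.+1)%N))
            (L n i *: falling 'X i).[k%:R] =
          \sum_(i < n.+1 | i != Ordinal (kn : (k < n.+1)%N))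
            (L' n i *: falling 'X i).[k%:R].
  apply: eq_bigr => i; rewrite -val_eqE /= !hornerZ => ik.
  have [lt_ik|ki] := ltnP i k.
    by rewrite IHk // (leq_trans (ltnW lt_ik)).
  have lt_ki : (k < i)%N by rewrite ltn_neqAle eq_sym ik.
  rewrite horner_falling /falling (bigD1 (Ordinal lt_ki)) //=.
  by rewrite subrr mul0r !mulr0.
move/addIr; rewrite !hornerZ horner_falling; apply: mulIf.
apply/prodf_neq0 => i _; rewrite -natrB ?pnatr_eq0 ?(ltnW (ltn_ord i)) //.
by rewrite subn_eq0 -ltnNge.
Qed.

Definition rLah (R : realType) (r : nat) : nat -> nat -> R :=
  sval (cid (is_rLah_exists R r)).

Lemma rLahP (R : realType) (r : nat) : is_rLah r (@rLah R r).
Proof. exact: svalP (cid (is_rLah_exists R r)). Qed.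

Definition rLahBell (R : realType) (r n : nat) : {poly R} :=
  \sum_(k < n.+1) rLah R r n k *: 'X^k.

(* Main.v *)
Require Import Defs.
From HB Require Import structures.
From mathcomp Require Import all_boot all_order all_algebra.
From mathcomp Require Import all_classical all_reals all_analysis.

Import Order.TTheory GRing.Theory Num.Theory.
Import numFieldNormedType.Exports.

Local Open Scope classical_set_scope.
Local Open Scope ring_scope.

(** Evaluating the defining identity of the [r]-Lah numbers at [k] writes
    the series as a finite combination of the series
    [\sum_k falling k j / k! * x ^ k], each of which is the exponential series
    shifted by [j] places, with sum [x ^ j * exp x]. *)

Lemma horner_falling (R : realType) (j : nat) (x : R) :
  (falling 'X j).[x] = falling x j.
Proof.
rewrite /falling horner_prod; apply: eq_bigr => i _.
by rewrite -polyC_natr hornerXsubC.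
Qed.

Lemma horner_rising (R : realType) (p : {poly R}) (n : nat) (x : R) :
  (rising p n).[x] = rising p.[x] n.
Proof.
rewrite /rising horner_prod; apply: eq_bigr => i _.
by rewrite -polyC_natr hornerD hornerC.
Qed.

(** Splitting off the first factor, not the last, gives at [x = k.+1] the factor [k.+1] that cancels
    against [k.+1]!. *)
Lemma fallingS (A : comNzRingType) (x : A) (j : nat) :
  falling x j.+1 = x * falling (x - 1) j.
Proof.
rewrite /falling big_ord_recl subr0; congr (_ * _).
apply: eq_bigr => i _.
by rewrite lift0 -addn1 natrD opprD addrCA addrC.
Qed.

Lemma rising_rLah (R : realType) (r n : nat) (x : R) :
  rising (x + r%:R) n = \sum_(j < n.+1) rLah R r n j * falling x j.
Proof.
have [HL _] := rLahP R r.
have := congr1 (fun p : {poly R} => p.[x]) (HL n).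
rewrite horner_rising horner_sum -polyC_natr hornerD hornerX hornerC => ->.
by apply: eq_bigr => j _; rewrite hornerZ horner_falling.
Qed.

Lemma cvg_series_falling (R : realType) (x : R) (j : nat) :
  series (fun k => falling (k%:R : R) j / k`!%:R * x ^+ k) @ \oo
    --> x ^+ j * expR x.
Proof.
elim: j => [|j IHj].
  rewrite expr0 mul1r.
  (* [expR x] is by definition the limit of this series, so its convergence is already the goal. *)
  rewrite (_ : (fun _ => _) = exp_coeff x); first exact: is_cvg_series_exp_coeff.
  by apply/funext => k; rewrite /falling big_ord0 div1r mulrC.
(* The partial sum of length [N.+1] for [j.+1] is exactly [x] times the one of length [N] for [j]:
   the term at 0 vanishes and the others move down by one index. *)
rewrite -cvg_shiftS /= exprS -mulrA.
rewrite (_ : (fun _ => _) = (fun N =>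
    x * series (fun k => falling (k%:R : R) j / k`!%:R * x ^+ k) N)).
  exact: cvgM (cvg_cst _) IHj.
apply/funext => N; rewrite /series /= big_nat_recl //.
rewrite fallingS !mul0r add0r mulr_sumr; apply: eq_bigr => k _.
have k0 : (k.+1%:R : R) != 0 by rewrite pnatr_eq0.
rewrite fallingS -natr1 addrK natr1 factS natrM -mulf_div.
by rewrite divff // mul1r exprS mulrCA.
Qed.

Theorem mainTheorem10 (R : realType) (r n : nat) (x : R) :
  let u := fun k : nat => rising (k%:R + r%:R : R) n / k`!%:R * x ^+ k in
  cvgn (series u) /\
  (rLahBell R r n).[x] = expR (- x) * limn (series u).
Proof.
move=> u.
(* This single limit yields both claims. *)
have u_cvg : series u @ \oo --> (rLahBell R r n).[x] * expR x.
  rewrite (_ : series u = fun N => \sum_(j < n.+1) rLah R r n j *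
      series (fun k => falling (k%:R : R) j / k`!%:R * x ^+ k) N); last first.
    apply/funext => N; rewrite /series /=.
    under [RHS]eq_bigr do rewrite mulr_sumr.
    (* The interchange takes place in partial sums, where both sums are finite, so no summability
       argument arises. *)
    rewrite exchange_big /=; apply: eq_bigr => k _.
    rewrite /u rising_rLah !mulr_suml; apply: eq_bigr => j _.
    by rewrite !mulrA.
  rewrite /rLahBell horner_sum mulr_suml.
  apply: cvg_big => [|j _]; first exact: add_continuous.
  rewrite hornerZ hornerXn -mulrA.
  exact: cvgM (cvg_cst _) (cvg_series_falling _ _ _).
split; first by apply/cvg_ex; exists ((rLahBell R r n).[x] * expR x).
by rewrite (cvg_lim _ u_cvg) // mulrCA -expRD addNr expR0 mulr1.
Qed.
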